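(* Let $K$ be a field. Let $(X,r)$ be a finite non-degenerate $\mathrm{SD}$ braided set, with $r(x,y)=(\sigma_x(y),x)$ for all $x,y\in X$, and let $A=A(K,X,r)$ be its structure $K$-algebra, with homogeneous component $A_2$ of degree $2$. Then $\dim_K (A_2)\geq \frac{|X|}{2}$. Furthermore, if $|X|$ is even, then the lower bound $\frac{|X|}{2}$ is reached (i.e. $\dim_K(A_2)=\frac{|X|}{2}$) precisely when all $\sigma_x$, with $x\in X$, are equal to one and the same cycle $\sigma$ of length $|X|$. If $|X|$ is odd, then the lower bound $\frac{|X|+1}{2}$ is reached (i.e. $\dim_K(A_2)=\frac{|X|+1}{2}$) when all $\sigma_x$, with $x\in X$, are equal to one and the same cycle $\sigma$ of length $|X|$. In particular, in these cases $r(a,b)=(\sigma(b),a)$ for all $a,b\in X$ and thus the solution $(X,r)$ is an indecomposable multipermutation solution of level $1$.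
   Context: A quadratic set $(X,r)$ is a nonempty set $X$ with a bijective map $r\colon X\times X\to X\times X$, written $r(x,y)=(\sigma_x(y),\gamma_y(x))$. It is non-degenerate if all $\sigma_x$ and $\gamma_x$ are bijective. It is a braided set if $r_1r_2r_1=r_2r_1r_2$ on $X^3$, where $r_1=r\times \mathrm{id}_X$ and $r_2=\mathrm{id}_X\times r$. It is $\mathrm{SD}$ if all $\gamma_y=\mathrm{id}$, i.e. $r(x,y)=(\sigma_x(y),x)$ for all $x,y\in X$. The structure algebra is the $K$-algebra $A(K,X,r)=K\langle X\mid xy=uv \text{ whenever } r(x,y)=(u,v)\rangle$; it is graded by word length, $A=\bigoplus_{m\ge 0}A_m$, where $A_m$ is the $K$-span of all products $x_1\cdots x_m$ with $x_i\in X$. For a non-degenerate braided set $(X,r)$, let $x\sim y$ if and only if $\sigma_x=\sigma_y$ and $\gamma_x=\gamma_y$. This is an equivalence relation, and the retraction $\mathrm{Ret}(X,r)$ is the non-degenerate braided set $(X/{\sim},\overline r)$ with $\overline r([x],[y])=([\sigma_x(y)],[\gamma_y(x)])$. Put $\mathrm{Ret}^0(X,r)=(X,r)$ and $\mathrm{Ret}^{n+1}(X,r)=\mathrm{Ret}(\mathrm{Ret}^n(X,r))$. The braided set is multipermutation of level $n$ if $n$ is the minimal non-negative integer such that the underlying set of $\mathrm{Ret}^n(X,r)$ has cardinality one. A non-degenerate braided set $(X,r)$ is decomposable if $X$ is a disjoint union of two nonempty subsets $Y,Z$ such that $r$ restricts to non-degenerate braided sets on $Y$ and on $Z$ (in particular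 $r(Y\times Y)= Y\times Y$ and $r(Z\times Z)= Z\times Z$); otherwise it is indecomposable.
   Formalization: The claim that the solution is multipermutation of level 1 is stated only for |X| > 1, since a one-element solution has level 0 by the definition of level; all other claims include |X| = 1. *)

(* Defs.v *)
From HB Require Import structures.
From mathcomp Require Import all_boot all_order all_algebra generic_quotient.
From mathcomp Require Import ring_quotient.
From mathcomp Require Import boolp.
From mathcomp Require Import finmap.
From mathcomp.multinomials Require Import monalg.

Set Implicit Arguments.
Unset Strict Implicit.
Unset Printing Implicit Defensive.

Import GRing.Theory.

Section QuadraticSets.
Variables (X : finType) (r : X * X -> X * X).

(* r (x, y) = (sigma x y, gamma y x) *)
Definition sigma (x y : X) : X := (r (x, y)).1.
Definition gamma (y x : X) : X := (r (x, y)).2.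

Definition quadratic_set : Prop := 0 < #|X| /\ bijective r.

Definition nondegenerate : Prop :=
  (forall x, bijective (sigma x)) /\ (forall x, bijective (gamma x)).

Definition r1 (p : X * X * X) : X * X * X :=
  let: (x, y, z) := p in (r (x, y), z).
Definition r2 (p : X * X * X) : X * X * X :=
  let: (x, y, z) := p in let: (u, v) := r (y, z) in (x, u, v).

Definition braided : Prop := r1 \o r2 \o r1 =1 r2 \o r1 \o r2.

Definition SD : Prop := forall y x, gamma y x = x.

Definition nondeg_braided_set : Prop :=
  [/\ quadratic_set, nondegenerate & braided].

End QuadraticSets.

Section Decomposability.
Variables (X : finType) (r : X * X -> X * X).

Definition restricts_to_nondeg_braided_set (Y : {set X}) : Prop :=
  exists2 rY : {y | y \in Y} * {y | y \in Y} -> {y | y \in Y} * {y | y \in Y},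
    (forall p, (val (rY p).1, val (rY p).2) = r (val p.1, val p.2))
    & nondeg_braided_set rY.

Definition decomposable : Prop :=
  exists Y Z : {set X},
    [/\ Y != set0, Z != set0, Y :|: Z = setT, [disjoint Y & Z]
      & restricts_to_nondeg_braided_set Y /\
        restricts_to_nondeg_braided_set Z].

Definition indecomposable : Prop := ~ decomposable.

End Decomposability.

Section Retraction.
Variables (X : finType) (r : X * X -> X * X).

Definition retract_rel : rel X := fun x y =>
  [forall z, (sigma r x z == sigma r y z) && (gamma r x z == gamma r y z)].

Lemma retract_relP x y :
  reflect (sigma r x =1 sigma r y /\ gamma r x =1 gamma r y) (retract_rel x y).
Proof.
apply: (iffP forallP) => [h|[h1 h2] z]; last by rewrite h1 h2 !eqxx.
by split=> z; have /andP[/eqP ? /eqP ?] := h z.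
Qed.

Lemma retract_rel_equiv : equiv_class_of retract_rel.
Proof.
split=> [x|x y|y x z].
- exact/retract_relP.
- by apply/retract_relP/retract_relP => -[h1 h2]; split=> z; rewrite ?h1 ?h2.
- move=> /retract_relP[h1 h2] /retract_relP[h3 h4].
  by apply/retract_relP; split=> t; rewrite ?h1 ?h2 ?h3 ?h4.
Qed.

Canonical retract_equiv := EquivRelPack retract_rel_equiv.
Canonical retract_encModRel := defaultEncModRel retract_rel.

Local Open Scope quotient_scope.

Definition retract := {eq_quot retract_rel}.
HB.instance Definition _ := Quotient.on retract.
HB.instance Definition _ := [Sub retract by %/].
HB.instance Definition _ := [Finite of retract by <:].

Lemma retract_piP x y :
  reflect (\pi_retract x = \pi_retract y) (retract_rel x y).
Proof. exact: eqmodP. Qed.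

(* Defined through representatives; see [retract_mapE] for the independence of
   their choice. *)
Definition retract_map (p : retract * retract) : retract * retract :=
  (\pi_retract (sigma r (repr p.1) (repr p.2)),
   \pi_retract (gamma r (repr p.2) (repr p.1))).

Lemma braid_sigma : braided r ->
  forall x y z, sigma r x (sigma r y z) =
    sigma r (sigma r x y) (sigma r (gamma r y x) z).
Proof.
move=> br x y z; have := br (x, y, z).
rewrite /= /r1 /r2 /sigma /gamma.
case: (r (x, y)) => a b /=; case: (r (y, z)) => c d /=.
case: (r (b, z)) => e f /=; case: (r (x, c)) => g h /=.
by case: (r (a, e)) => i j; case: (r (h, d)) => k l [] -> _ _.
Qed.

Lemma braid_gamma : braided r ->
  forall x y z, gamma r z (gamma r y x) =
    gamma r (gamma r z y) (gamma r (sigma r y z) x).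
Proof.
move=> br x y z; have := br (x, y, z).
rewrite /= /r1 /r2 /sigma /gamma.
case: (r (x, y)) => a b /=; case: (r (y, z)) => c d /=.
case: (r (b, z)) => e f /=; case: (r (x, c)) => g h /=.
by case: (r (a, e)) => i j; case: (r (h, d)) => k l [] _ _ ->.
Qed.

Lemma retract_mapE : nondeg_braided_set r -> forall x y,
  retract_map (\pi_retract x, \pi_retract y) =
  (\pi_retract (sigma r x y), \pi_retract (gamma r y x)).
Proof.
case=> _ [sbij gbij] br x y; rewrite /retract_map /=.
have /retract_relP[sx gx] : retract_rel (repr (\pi_retract x)) x.
  by apply/retract_piP; rewrite reprK.
have /retract_relP[sy gy] : retract_rel (repr (\pi_retract y)) y.
  by apply/retract_piP; rewrite reprK.
set x' := repr _ in sx gx *; set y' := repr _ in sy gy *.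
have surj (f : X -> X) : bijective f -> forall t, exists u, f u = t.
  by case=> g _ fK t; exists (g t); rewrite fK.
congr (_, _); apply/retract_piP/retract_relP.
- rewrite sx; split=> t.
    have [u <-] := surj _ (sbij (gamma r y x)) t.
    by rewrite -{1}gy -!braid_sigma // sy.
  apply: (bij_inj (gbij (gamma r y x))).
  by rewrite -{1}gy -!braid_gamma // gy.
- rewrite gy; split=> t.
    apply: (bij_inj (sbij (sigma r x y))).
    by rewrite -{1}sx -!braid_sigma // sx.
  have [u <-] := surj _ (gbij (sigma r x y)) t.
  by rewrite -{1}sx -!braid_gamma // gx.
Qed.

End Retraction.

Record quadratic_data := QuadraticData {
  carrier : finType;
  braiding : carrier * carrier -> carrier * carrier
}.

Arguments braiding : clear implicits.

Definition Ret (Q : quadratic_data) : quadratic_data :=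
  @QuadraticData (retract (braiding Q)) (@retract_map _ (braiding Q)).

Definition mpl (X : finType) (r : X * X -> X * X) (n : nat) : Prop :=
  let Q := QuadraticData r in
  #|carrier (iter n Ret Q)| = 1 /\
  forall m, m < n -> #|carrier (iter m Ret Q)| <> 1.

Local Open Scope ring_scope.

Section TwoSidedIdeals.

Definition two_sided_ideal (R : nzRingType) (J : R -> Prop) : Prop :=
  [/\ J 0, forall f g, J f -> J g -> J (f + g)
    & forall f g, J f -> J (g * f) /\ J (f * g)].

Lemma two_sided_idealN (R : nzRingType) (J : R -> Prop) f :
  two_sided_ideal J -> J f -> J (- f).
Proof. by case=> _ _ JM Jf; have [+ _] := JM _ (-1) Jf; rewrite mulN1r. Qed.

Lemma two_sided_idealZ (K : fieldType) (R : lalgType K) (J : R -> Prop) c f :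
  two_sided_ideal J -> J f -> J (c *: f).
Proof. by case=> _ _ JM Jf; have [+ _] := JM _ c%:A Jf; rewrite mulr_algl. Qed.

Lemma two_sided_ideal_ker (R S : nzRingType) (phi : {rmorphism R -> S}) :
  two_sided_ideal (fun f => phi f = 0).
Proof.
split=> [|f g f0 g0|f g f0]; first exact: rmorph0.
  by rewrite rmorphD f0 g0 addr0.
by rewrite !rmorphM f0 mulr0 mul0r.
Qed.

Lemma rmorph_relator0 (R S : nzRingType) (phi : {rmorphism R -> S}) a b c d :
  phi a = 0 -> phi c = 0 -> phi (a * b - c * d) = 0.
Proof. by move=> a0 c0; rewrite rmorphB !rmorphM a0 c0 !mul0r subrr. Qed.

Lemma two_sided_ideal_eqM (R : nzRingType) (J : R -> Prop) f f' g g' :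
  two_sided_ideal J -> J (f - f') -> J (g - g') -> J (f * g - f' * g').
Proof.
case=> _ JD JM Jf Jg; have -> : f * g - f' * g' = (f - f') * g + f' * (g - g').
  by rewrite mulrBl mulrBr addrA subrK.
by apply: JD; [case: (JM _ g Jf)|case: (JM _ f' Jg)].
Qed.

End TwoSidedIdeals.

Section StructureAlgebra.
Variables (K : fieldType) (X : finType) (r : X * X -> X * X).

Definition free_algebra := {malg K[{fmonom X}]}.

HB.instance Definition _ := GRing.Lalgebra.on free_algebra.

Definition free_gen (x : X) : free_algebra := << fmu x >>.

Definition relator (x y : X) : free_algebra :=
  free_gen x * free_gen y -
  free_gen (r (x, y)).1 * free_gen (r (x, y)).2.

Definition rel_ideal : {pred free_algebra} := fun f =>
  `[< forall J, two_sided_ideal J -> (forall x y, J (relator x y)) -> J f >].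

Lemma rel_idealP : two_sided_ideal (fun f => f \in rel_ideal).
Proof.
split.
- by apply/asboolP => J [].
- move=> f g /asboolP If /asboolP Ig; apply/asboolP => J JI Jr.
  by have [_ JD _] := JI; apply: JD; [apply: If|apply: Ig].
- move=> f g /asboolP If; split; apply/asboolP => J JI Jr;
    have [_ _ JM] := JI; by case: (JM f g (If J JI Jr)).
Qed.

Lemma rel_ideal_zmod_closed : zmod_closed rel_ideal.
Proof.
have [I0 ID _] := rel_idealP; split=> // f g If Ig; apply: ID => //.
exact: (two_sided_idealN rel_idealP Ig).
Qed.

HB.instance Definition _ :=
  GRing.isZmodClosed.Build free_algebra rel_ideal rel_ideal_zmod_closed.

Lemma rel_ideal1 : 1 \notin rel_ideal.
Proof.
pose phi : {rmorphism free_algebra -> K} := mcoeff (@mone {fmonom X}).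
apply/asboolP => /(_ (fun f => phi f = 0) (two_sided_ideal_ker phi)) H.
have /eqP : phi 1 = 0.
  apply: H => x y; apply: rmorph_relator0;
  by rewrite /phi /= mcoeffU1 fm1_eq1.
by rewrite rmorph1 oner_eq0.
Qed.

Local Open Scope quotient_scope.

Definition structure_algebra := {ideal_quot (rel_ideal : zmodClosed free_algebra)}.
Local Notation A := structure_algebra.

HB.instance Definition _ := GRing.Zmodule.on A.

Definition sa_pi (f : free_algebra) : A := \pi_A f.

Lemma sa_piE f g : (sa_pi f = sa_pi g) <-> (f - g \in rel_ideal).
Proof.
by rewrite (Quotient.idealrBE rel_ideal); split=> [/eqP|/eqP].
Qed.

Lemma sa_pi_surj a : sa_pi (repr a) = a. Proof. exact: reprK. Qed.

Lemma sa_piB : {morph sa_pi : f g / f - g}.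
Proof. exact: raddfB. Qed.
Lemma sa_piD : {morph sa_pi : f g / f + g}.
Proof. exact: raddfD. Qed.

Definition sa_mul (a b : A) : A := sa_pi (repr a * repr b).
Definition sa_one : A := sa_pi 1.
Definition sa_scale (c : K) (a : A) : A := sa_pi (c *: repr a).

Lemma sa_piM f g : sa_pi (f * g) = sa_mul (sa_pi f) (sa_pi g).
Proof.
by apply/sa_piE/(two_sided_ideal_eqM rel_idealP); apply/sa_piE;
   rewrite sa_pi_surj.
Qed.

Lemma sa_piZ c f : sa_pi (c *: f) = sa_scale c (sa_pi f).
Proof.
apply/sa_piE; rewrite -scalerBr; apply: (two_sided_idealZ c rel_idealP).
by apply/sa_piE; rewrite sa_pi_surj.
Qed.

Fact sa_mulA : associative sa_mul.
Proof.
by move=> a b c; rewrite -[a]sa_pi_surj -[b]sa_pi_surj -[c]sa_pi_surj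
   -!sa_piM mulrA.
Qed.
Fact sa_mul1 : left_id sa_one sa_mul.
Proof. by move=> a; rewrite -[a]sa_pi_surj -sa_piM mul1r. Qed.
Fact sa_mulr1 : right_id sa_one sa_mul.
Proof. by move=> a; rewrite -[a]sa_pi_surj -sa_piM mulr1. Qed.
Fact sa_mulDl : left_distributive sa_mul +%R.
Proof.
by move=> a b c; rewrite -[a]sa_pi_surj -[b]sa_pi_surj -[c]sa_pi_surj
   -!(sa_piM, sa_piD) mulrDl.
Qed.
Fact sa_mulDr : right_distributive sa_mul +%R.
Proof.
by move=> a b c; rewrite -[a]sa_pi_surj -[b]sa_pi_surj -[c]sa_pi_surj
   -!(sa_piM, sa_piD) mulrDr.
Qed.
Fact sa_one_neq0 : sa_one != 0.
Proof.
have z : sa_pi 0 = 0 by rewrite -[X in sa_pi X](subrr 0) sa_piB subrr.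
apply/eqP; rewrite -z.
by move/sa_piE; rewrite subr0 (negPf rel_ideal1).
Qed.

HB.instance Definition _ := GRing.Zmodule_isNzRing.Build A
  sa_mulA sa_mul1 sa_mulr1 sa_mulDl sa_mulDr sa_one_neq0.

Fact sa_scaleA c d a : sa_scale c (sa_scale d a) = sa_scale (c * d) a.
Proof. by rewrite -[a]sa_pi_surj -!sa_piZ scalerA. Qed.
Fact sa_scale1 : left_id 1 sa_scale.
Proof. by move=> a; rewrite -[a]sa_pi_surj -!sa_piZ scale1r. Qed.
Fact sa_scaleDr : right_distributive sa_scale +%R.
Proof.
by move=> c a b; rewrite -[a]sa_pi_surj -[b]sa_pi_surj
   -!(sa_piZ, sa_piD) scalerDr.
Qed.
Fact sa_scaleDl a : {morph sa_scale^~ a : c d / c + d}.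
Proof.
by move=> c d; rewrite -[a]sa_pi_surj -!(sa_piZ, sa_piD) scalerDl.
Qed.

HB.instance Definition _ := GRing.Zmodule_isLmodule.Build K A
  sa_scaleA sa_scale1 sa_scaleDr sa_scaleDl.

Fact sa_scaleAl (c : K) (a b : A) : c *: (a * b) = c *: a * b.
Proof.
rewrite -[a]sa_pi_surj -[b]sa_pi_surj.
change (sa_scale c (sa_mul (sa_pi (repr a)) (sa_pi (repr b))) =
  sa_mul (sa_scale c (sa_pi (repr a))) (sa_pi (repr b))).
by rewrite -!(sa_piM, sa_piZ) scalerAl.
Qed.

HB.instance Definition _ := GRing.Lmodule_isLalgebra.Build K A sa_scaleAl.

Lemma free_algebra_scaleAr (c : K) (f g : free_algebra) :
  c *: (f * g) = f * (c *: g).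
Proof.
have C h : c%:MP * h = h * c%:MP :> free_algebra.
  rewrite [LHS]malgME [RHS]malgME exchange_big /=.
  apply: eq_bigr => k _; apply: eq_big_seq => l.
  rewrite msuppC; case: ifP => [_|_]; first by rewrite in_fset0.
  rewrite in_fset1 => /eqP ->.
  by rewrite mulrC mul1m mulm1.
by rewrite -!mul_malgC mulrA C mulrA.
Qed.

Fact sa_scaleAr (c : K) (a b : A) : c *: (a * b) = a * (c *: b).
Proof.
rewrite -[a]sa_pi_surj -[b]sa_pi_surj.
change (sa_scale c (sa_mul (sa_pi (repr a)) (sa_pi (repr b))) =
  sa_mul (sa_pi (repr a)) (sa_scale c (sa_pi (repr b)))).
by rewrite -!(sa_piM, sa_piZ) free_algebra_scaleAr.
Qed.

HB.instance Definition _ := GRing.Lalgebra_isAlgebra.Build K A sa_scaleAr.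

Definition sa_gen (x : X) : A := sa_pi (free_gen x).

End StructureAlgebra.

Section Dimension.
Variables (K : fieldType) (V : lmodType K).

Definition lspan (I : finType) (v : I -> V) : V -> Prop :=
  fun u => exists c : I -> K, u = \sum_i c i *: v i.

Definition lin_indep (I : finType) (v : I -> V) : Prop :=
  forall c : I -> K, \sum_i c i *: v i = 0 -> forall i, c i = 0.

Definition has_dim (S : V -> Prop) (n : nat) : Prop :=
  exists2 v : 'I_n -> V, lin_indep v & forall u, S u <-> lspan v u.

Lemma has_dim_leq S n m : has_dim S n -> has_dim S m -> (n <= m)%N.
Proof.
case=> v vfree vS [w wfree wS]; rewrite leqNgt; apply/negP => ltmn.
have /choice[c cE] : forall i, exists c : 'I_m -> K,
    v i = \sum_j c j *: w j.
  move=> i; apply/wS/vS; exists (fun j => (j == i)%:R).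
  rewrite (bigD1 i) //= eqxx scale1r big1 ?addr0 // => j /negPf ->.
  by rewrite scale0r.
pose M := \matrix_(i < n, j < m) c i j.
have : kermx M != 0.
  rewrite -mxrank_eq0 mxrank_ker subn_eq0 -ltnNge.
  exact: leq_ltn_trans (rank_leq_col M) ltmn.
case/rowV0Pn => a /sub_kermxP aM /eqP; apply.
apply/rowP => i; rewrite mxE; apply: (vfree (a 0)).
under eq_bigr do rewrite cE scaler_sumr.
rewrite exchange_big /= big1 // => j _.
under eq_bigr do rewrite scalerA.
rewrite -scaler_suml; have /rowP/(_ j) := aM; rewrite !mxE.
by under eq_bigr do rewrite mxE; move=> ->; rewrite scale0r.
Qed.

Lemma has_dim_uniq S n m : has_dim S n -> has_dim S m -> n = m.
Proof. by move=> hn hm; apply/eqP; rewrite eqn_leq !(@has_dim_leq S). Qed.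

(* 0 when S is not a finite-dimensional subspace *)
Definition dimK (S : V -> Prop) : nat :=
  if pselect (exists n, has_dim S n) is left ex then projT1 (cid ex) else 0%N.

Lemma dimKE S n : has_dim S n -> dimK S = n.
Proof.
move=> hn; rewrite /dimK; case: pselect => [ex|[]]; last by exists n.
by case: cid => m hm /=; apply: (has_dim_uniq hm hn).
Qed.

End Dimension.

Definition homog (K : fieldType) (X : finType) (r : X * X -> X * X) (m : nat) :
    structure_algebra K r -> Prop :=
  lspan (fun t : m.-tuple X => \prod_(x <- t) sa_gen K r x).

Arguments homog : clear implicits.
Arguments homog K {X} r m.

(* s is the k-cycle (c_1 c_2 ... c_k), fixing the points outside c; for k = 1
   this is the identity. *)
Definition is_cycle_of_length (X : finType) (s : X -> X) (k : nat) : Prop :=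
  exists c : seq X, [/\ uniq c, size c = k & s =1 next c].

Definition all_sigma_eq_cycle (X : finType) (r : X * X -> X * X) : Prop :=
  exists s : X -> X,
    is_cycle_of_length s #|X| /\ forall x, sigma r x =1 s.

(* Main.v *)
Require Import Defs.
From mathcomp Require Import all_boot all_order all_algebra.
From mathcomp Require Import generic_quotient boolp finmap zify.
From mathcomp.multinomials Require Import monalg.

(** The relations of A in degree 2 only identify the word x y with the word
    r (x, y), so dim A_2 is the number N of orbits of r on X * X
    ([dim_homog2]): the orbits span A_2, and they are independent because the
    map sending a noncommutative polynomial to the sum of its coefficients on
    the words of a given orbit vanishes on the ideal of relations.

    To count orbits, consider the diagonal map U x = sigma_x x. The braid
    relation at (x, x) gives sigma_(U x) = sigma_x, so U is injective and sigma
    is constant on each cycle C of U. Hence r (x, y) = (U y, x) on C * C: this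
    square is a union of r-orbits, on which r is the solution attached to a
    single cyclic permutation. Identify C with Z/l and U with the successor;
    then r exchanges the differences j and -1 - j of the two coordinates, so
    that C * C contains at least l/2 orbits. Summing over the cycles of U gives
    N >= |X|/2. The sum is carried out at once by sending x to the orbit of
    (c, x), where c is a base point of the cycle of x: this map is at most
    two-to-one ([anchored_orbit_fibre]).

    If 2 N = |X|, there is no orbit outside the squares C * C, so U has a
    single cycle, which means that all sigma_x equal U and that U is a cycle of
    length |X| ([all_sigma_eq_cycleP]). Conversely, if U is a single cycle of
    length n, every orbit meets the pairs (c, U^i c), and i may be replaced by
    n - 1 - i, so N <= (n + 1)/2 ([transitive_leq_froots]). *)

Set Implicit Arguments.
Unset Strict Implicit.
Unset Printing Implicit Defensive.

Import Order.TTheory GRing.Theory Num.Theory.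
Local Open Scope ring_scope.

(** * Spans of finite families *)

Section LinearSpan.
Variables (K : fieldType) (V : lmodType K).

Lemma lspan_gen (I : finType) (v : I -> V) i : lspan v (v i).
Proof.
exists (fun j => (j == i)%:R); rewrite (bigD1 i) //= eqxx scale1r big1 ?addr0 //.
by move=> j /negPf ->; rewrite scale0r.
Qed.

Lemma lspan_trans (I J : finType) (v : I -> V) (w : J -> V) u :
  (forall i, lspan w (v i)) -> lspan v u -> lspan w u.
Proof.
move=> /choice[c vE] [a ->]; exists (fun j => \sum_i a i * c i j).
under eq_bigr do rewrite vE scaler_sumr.
rewrite exchange_big; apply: eq_bigr => j _.
by rewrite scaler_suml; apply: eq_bigr => i _; rewrite scalerA.
Qed.

End LinearSpan.

(** * The dimension of the quadratic component *)

Section DegreeTwo.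
Variables (K : fieldType) (X : finType) (r : X * X -> X * X).

Local Notation free := (free_algebra K X).

Lemma free_gen_mul x y :
  free_gen K x * free_gen K y = << mmul (fmu x) (fmu y) >> :> free.
Proof.
rewrite /free_gen malgME msuppU oner_eq0 big_seq_fset1 msuppU oner_eq0.
by rewrite big_seq_fset1 !mcoeffUU mulr1.
Qed.

Section Functional.
Variable chi : seq X -> K.

(** The linear form on polynomials whose value at a word w is chi (u w v). The
    contexts u and v are there so that the common kernel of all these forms is
    a two-sided ideal, the largest one on which the linear extension of chi
    vanishes. *)
Definition ctx_form (u v : {fmonom X}) (f : free) : K :=
  mmap idfun (fun w : {fmonom X} => chi (u ++ w ++ v)) f.

Lemma ctx_formZ u v c f : ctx_form u v (c *: f) = c * ctx_form u v f.
Proof.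
rewrite /ctx_form (mmapEw (msuppZ_le c f)) mmapE mulr_sumr.
by apply: eq_bigr => w _; rewrite linearZ /= mulrA.
Qed.

Lemma ctx_form_quad x y :
  ctx_form mone mone << mmul (fmu x) (fmu y) >> = chi [:: x; y].
Proof. by rewrite /ctx_form mmapU /= mul1r !fmM !fmU !fm1. Qed.

Lemma ctx_formMl u v g f :
  ctx_form u v (g * f) =
  \sum_(k <- msupp g) g@_k * ctx_form (mmul u k) v f.
Proof.
rewrite /ctx_form malgME raddf_sum /=; apply: eq_bigr => k _.
rewrite raddf_sum mmapE mulr_sumr /=; apply: eq_bigr => l _.
by rewrite mmapU /= !fmM -!catA mulrA.
Qed.

Lemma ctx_formMr u v g f :
  ctx_form u v (f * g) =
  \sum_(k <- msupp g) g@_k * ctx_form u (mmul k v) f.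
Proof.
rewrite /ctx_form malgME exchange_big raddf_sum /=; apply: eq_bigr => k _.
rewrite raddf_sum mmapE mulr_sumr /=; apply: eq_bigr => l _.
by rewrite mmapU /= !fmM -!catA mulrCA mulrA.
Qed.

Lemma ctx_form_ideal :
  two_sided_ideal (fun f : free => forall u v, ctx_form u v f = 0).
Proof.
split=> [u v|f g f0 g0 u v|f g f0]; first exact: raddf0.
  by rewrite /ctx_form raddfD /= [X in X + _]f0 [X in _ + X]g0 addr0.
split=> u v.
  by rewrite ctx_formMl big1 // => k _; rewrite f0 mulr0.
by rewrite ctx_formMr big1 // => k _; rewrite f0 mulr0.
Qed.

Hypothesis chi_r : forall u v x y,
  chi (u ++ [:: x; y] ++ v) =
  chi (u ++ [:: (r (x, y)).1; (r (x, y)).2] ++ v).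

(** A function on words that is unchanged by rewriting along r inside a word
    descends to the structure algebra: the relators lie in the ideal of
    [ctx_form_ideal]. *)
Lemma ctx_form_rel_ideal f u v :
  f \in rel_ideal (K := K) r -> ctx_form u v f = 0.
Proof.
move=> /asboolP If; move: u v.
apply: (If _ ctx_form_ideal) => x y u v.
rewrite /relator !free_gen_mul /ctx_form raddfB /= !mmapU /= !fmM !fmU.
by rewrite !mul1r chi_r subrr.
Qed.

End Functional.

Hypothesis r_inj : injective r.

Let word_root_form (p : X * X) (w : seq X) : K :=
  if w is [:: x; y] then (froot r (x, y) == p)%:R else 0.

Lemma word_root_form_r p u v x y :
  word_root_form p (u ++ [:: x; y] ++ v) =
  word_root_form p (u ++ [:: (r (x, y)).1; (r (x, y)).2] ++ v).
Proof.
case: u v => [|a [|b [|c u]]] [|d v] //=.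
rewrite -surjective_pairing; congr ((_ == p)%:R).
by apply/eqP; rewrite root_connect ?fconnect1 //; apply: fconnect_sym.
Qed.

Definition quad_mon (p : X * X) : structure_algebra K r :=
  sa_gen K r p.1 * sa_gen K r p.2.

Lemma quad_mon_pi p :
  quad_mon p = sa_pi r << mmul (fmu p.1) (fmu p.2) >>.
Proof. by case: p => x y /=; rewrite -(free_gen_mul x y) sa_piM. Qed.

Lemma quad_mon_r p : quad_mon (r p) = quad_mon p.
Proof.
case: p => x y; rewrite !quad_mon_pi -!free_gen_mul.
by apply/esym/sa_piE/asboolP => J _; apply.
Qed.

Lemma quad_mon_root p : quad_mon (froot r p) = quad_mon p.
Proof.
have /iter_findex <- := connect_root (frel r) p.
move: (findex _ _ _) => m; elim: m => [//|m IHm].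
by rewrite iterS quad_mon_r.
Qed.

Let root_mon (i : 'I_#|froots r|) := quad_mon (enum_val i).

(** The indicator form of the i-th orbit extracts the coefficient c i from a
    lift of the combination to the free algebra. *)
Lemma root_mon_free : lin_indep root_mon.
Proof.
move=> c c0 i.
pose f : free :=
  \sum_j c j *: << mmul (fmu (enum_val j).1) (fmu (enum_val j).2) >>.
have If : f \in rel_ideal (K := K) r.
  rewrite -[f]subr0; apply/sa_piE.
  have pi0 : sa_pi r 0 = 0 :> structure_algebra K r.
    by rewrite -[0]subr0 sa_piB subrr.
  rewrite pi0 -[RHS]c0 /f.
  rewrite (big_morph (sa_pi r) (@sa_piD K X r) pi0).
  by apply: eq_bigr => j _; rewrite sa_piZ /root_mon quad_mon_pi.
have formE j : ctx_form (word_root_form (enum_val i)) mone mone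
    (c j *: << mmul (fmu (enum_val j).1) (fmu (enum_val j).2) >>) =
    c j * (j == i)%:R.
  rewrite ctx_formZ ctx_form_quad /= -surjective_pairing.
  have /eqP -> : froots r (enum_val j) by apply: (enum_valP j).
  by rewrite (inj_eq enum_val_inj).
have := ctx_form_rel_ideal (word_root_form_r (enum_val i)) mone mone If.
rewrite /ctx_form raddf_sum /= (bigD1 i) //= big1 => [|j ji].
  by rewrite [X in X + _]formE eqxx mulr1 addr0.
by rewrite [LHS]formE (negPf ji) mulr0.
Qed.

(** Products of two generators are constant on r-orbits, so the orbit
    representatives span; they are independent by [root_mon_free]. *)
Lemma dim_homog2 : dimK (homog K r 2) = #|froots r|.
Proof.
apply: dimKE; exists root_mon; first exact: root_mon_free.
have prodE (t : 2.-tuple X) :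
    \prod_(x <- t) sa_gen K r x = quad_mon (tnth t ord0, tnth t ord_max).
  case/tupleP: t => x t; case/tupleP: t => y t; rewrite tuple0 /=.
  by rewrite !big_cons big_nil mulr1.
move=> u; split; apply: lspan_trans; [move=> t|move=> i].
  rewrite prodE -quad_mon_root; set p := froot r _.
  have rp : p \in froots r by apply: roots_root (fconnect_sym r_inj) _.
  by rewrite -(enum_rankK_in rp rp); apply: lspan_gen.
rewrite /root_mon; case: (enum_val i) => x y.
have := lspan_gen (fun t : 2.-tuple X => \prod_(z <- t) sa_gen K r z)
  [tuple x; y].
by rewrite prodE.
Qed.

End DegreeTwo.

(** * Orbits of the braiding and cycles of the diagonal map *)

Lemma leq_double_card_imset (T T' : finType) (f : T -> T') (h : T -> T) :
  (forall x y, f x = f y -> y = x \/ y = h x) ->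
  (#|T| <= #|f @: [set: T]|.*2)%N.
Proof.
move=> fibre; rewrite -cardsT -sum1_card (partition_big_imset f) /= -mul2n mulnC.
rewrite -sum_nat_const; apply: leq_sum => _ /imsetP[x _ ->].
rewrite sum1_card; apply: leq_trans (_ : #|[set x; h x]| <= 2)%N; last first.
  by rewrite cards2; case: eqP.
apply: subset_leq_card; apply/subsetP => y; rewrite !inE => /andP[_ /eqP/esym].
by move=> /fibre[]->; rewrite eqxx ?orbT.
Qed.

Section DiagonalMap.
Variables (X : finType) (r : X * X -> X * X).
Hypotheses (r_nbs : nondeg_braided_set r) (r_SD : SD r).

Let r_inj : injective r.
Proof. by case: r_nbs => -[_ /bij_inj]. Qed.
Local Notation r_sym := (fconnect_sym r_inj).

Definition diag_map (x : X) : X := sigma r x x.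
Local Notation U := diag_map.

Lemma SD_braidingE x y : r (x, y) = (sigma r x y, x).
Proof.
by have := r_SD y x; rewrite /sigma /gamma; case: (r (x, y)) => a b /= ->.
Qed.

(** The braid relation reads sigma_x sigma_x = sigma_(U x) sigma_x at the pair
    (x, x), and sigma_x is surjective. *)
Lemma sigma_diag_map x : sigma r (U x) =1 sigma r x.
Proof.
case: r_nbs => _ [sbij _] br y; have [g _ gK] := sbij x.
by have := braid_sigma br x x (g y); rewrite r_SD gK.
Qed.

(** If U x = U y then sigma_x = sigma_(U x) = sigma_(U y) = sigma_y, so x and y
    have the same image under the bijection sigma_x. *)
Lemma diag_map_inj : injective U.
Proof.
case: r_nbs => _ [sbij _] _ x y Uxy; apply: (bij_inj (sbij x)).
by rewrite -[RHS]sigma_diag_map Uxy sigma_diag_map -[RHS]Uxy.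
Qed.
Local Notation U_sym := (fconnect_sym diag_map_inj).

Lemma sigma_fconnect x y : fconnect U x y -> sigma r x =1 sigma r y.
Proof.
by move=> /iter_findex <- z; elim: findex => //= k ->; rewrite sigma_diag_map.
Qed.

Lemma braiding_fconnect x y : fconnect U x y -> r (x, y) = (U y, x).
Proof. by move=> /sigma_fconnect sxy; rewrite SD_braidingE sxy. Qed.

Lemma fconnect_diagS x y : fconnect U x y -> fconnect U (U y) x.
Proof. by move=> xy; rewrite U_sym -same_fconnect1_r //; exact: diag_map_inj. Qed.

Lemma iter_braiding_even k x y : fconnect U x y ->
  iter k.*2 r (x, y) = (iter k U x, iter k U y).
Proof.
move=> xy; elim: k => //= k ->; have xyk : fconnect U (iter k U x) (iter k U y).
  rewrite -(same_connect U_sym (fconnect_iter _ _ _)).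
  exact: connect_trans xy (fconnect_iter _ _ _).
by rewrite (braiding_fconnect xyk) (braiding_fconnect (fconnect_diagS xyk)).
Qed.

Lemma iter_braiding_odd k x y : fconnect U x y ->
  iter k.*2.+1 r (x, y) = (iter k.+1 U y, iter k U x).
Proof.
move=> xy; rewrite iterSr (braiding_fconnect xy) iter_braiding_even -?iterSr //.
exact: fconnect_diagS.
Qed.

(** The pairs with both coordinates in one cycle of U form a union of r-orbits:
    a pair with coordinates in two different cycles is in none of the orbits
    counted by the lower bound. *)
Lemma diag_fclosed : fclosed r [pred p : X * X | fconnect U p.1 p.2].
Proof.
apply: (intro_closed r_sym) => -[x y] _ /= /eqP <-.
by rewrite !inE /= => xy; rewrite braiding_fconnect // fconnect_diagS.
Qed.

(** [froot U x] serves as the base point of the cycle of x, so that all points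
    of a cycle are paired with the same first coordinate. *)
Definition anchored_orbit (x : X) : X * X := froot r (froot U x, x).

(** Suppose that r^m (c, x) = (c', y), with c and c' the base points of x and y.
    Both lie in the same cycle of U, so c = c'. If m = 2 k, then U^k fixes c,
    hence also x, and y = x. If m = 2 k + 1, then U^(k+1) x = c and y = U^k c;
    writing x = U^i c gives U^(i+1) y = c, which determines y from x. *)
Lemma anchored_orbit_fibre x y : anchored_orbit x = anchored_orbit y ->
  y = x \/ y = iter (findex U (froot U x) x).+1 (finv U) (froot U x).
Proof.
move=> /eqP; rewrite (root_connect r_sym) => xy.
have cx : fconnect U (froot U x) x by rewrite U_sym connect_root.
have cy : fconnect U (froot U y) y by rewrite U_sym connect_root.
move/iter_findex: xy; move: (findex _ _ _) => m.
rewrite -[m]odd_double_half; case: (odd m); last first.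
  rewrite add0n iter_braiding_even // => -[Ecc <-]; left.
  have ccxy : froot U x = froot U y.
    have : fconnect U (froot U x) (froot U y) by rewrite -Ecc fconnect_iter.
    by rewrite -(root_connect U_sym) !(root_root U_sym) => /eqP.
  rewrite -(iter_findex cx) -iterD addnC iterD Ecc -ccxy.
  by rewrite (iter_findex cx).
rewrite add1n iter_braiding_odd // => -[Ecc Ey]; right.
have ccxy : froot U x = froot U y.
  have : fconnect U x (froot U y) by rewrite -Ecc -iterS fconnect_iter.
  by rewrite -(root_connect U_sym) (root_root U_sym) => /eqP.
set i := findex _ _ _.
have iE : iter i U (froot U x) = x by apply: iter_findex.
(* U^(i+1) y = U^(i+1+k) c = U^(k+1) x, which is the base point of y. *)
have -> : froot U x = iter i.+1 U y.
  by rewrite {1}ccxy -Ecc -iE -Ey -!iterS -!iterD addSnnS addnC.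
elim: i.+1 => // j IHj.
by rewrite [iter _ U y]iterS iterSr finv_f //; apply: diag_map_inj.
Qed.

Let anchored_orbits := [set anchored_orbit x | x in [set: X]].

Lemma anchored_orbits_sub : anchored_orbits \subset froots r.
Proof.
by apply/subsetP => _ /imsetP[x _ ->]; apply: roots_root r_sym _.
Qed.

Lemma leq_double_froots : (#|X| <= #|froots r|.*2)%N.
Proof.
apply: leq_trans (leq_double_card_imset anchored_orbit_fibre) _.
by rewrite leq_double subset_leq_card // anchored_orbits_sub.
Qed.

(** The orbit of a pair (x, y) that is not in the square of a cycle of U would
    be missed by [anchored_orbit], whose image already has |X|/2 elements. *)
Lemma double_froots_transitive x y : #|froots r|.*2 = #|X| -> fconnect U x y.
Proof.
move=> cardX; apply/negPn/negP => nxy.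
suff : anchored_orbits \proper froots r.
  move=> /proper_card; rewrite -ltn_double cardX ltnNge.
  by rewrite (leq_double_card_imset anchored_orbit_fibre).
apply/properP; split; first exact: anchored_orbits_sub.
exists (froot r (x, y)); first exact: roots_root r_sym _.
apply/imsetP => -[z _ /eqP].
rewrite (root_connect r_sym) => /(closed_connect diag_fclosed).
by rewrite !inE /= (negPf nxy) U_sym connect_root.
Qed.

(** Moving the first coordinate to a fixed c along the cycle, every orbit
    contains some (c, U^i c) with i < n = |X|. An odd number of steps of r leads
    from (c, U^i c) to (c, U^(n-1-i) c), and one of i, n - 1 - i is below
    (n + 1)/2. *)
Lemma transitive_leq_froots : (forall x y, fconnect U x y) ->
  (#|froots r| <= uphalf #|X|)%N.
Proof.
move=> Utr; case: r_nbs => -[/card_gt0P[c _] _ _ _].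
have orderE x : order U x = #|X| by apply: eq_card => y; rewrite !inE Utr.
pose g (i : 'I_(uphalf #|X|)) := froot r (c, iter i U c).
apply: leq_trans (_ : #|g @: [set: 'I_(uphalf #|X|)]| <= _)%N; last first.
  by rewrite (leq_trans (leq_imset_card _ _)) // cardsT card_ord.
apply/subset_leq_card/subsetP => -[a b] /eqP rab; rewrite -rab.
have acb : fconnect r (a, b) (c, iter (findex U a c) U b).
  rewrite -{1}(iter_findex (Utr a c)) -iter_braiding_even //.
  exact: fconnect_iter.
move: (iter _ U b) acb => d; rewrite -(root_connect r_sym) => /eqP ->.
have := findex_max (Utr c d); rewrite orderE; move: (iter_findex (Utr c d)).
move: (findex U c d) => i <- ltin.
have [lti|leiN] := ltnP i (uphalf #|X|).
  by apply/imsetP; exists (Ordinal lti).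
have ltj : (#|X| - i.+1 < uphalf #|X|)%N.
  move: leiN ltin; rewrite uphalf_half; have := odd_double_half #|X|.
  by case: odd; lia.
apply/imsetP; exists (Ordinal ltj) => //; apply/eqP.
rewrite (root_connect r_sym).
suff <- : iter (#|X| - i.+1).*2.+1 r (c, iter i U c) =
    (c, iter (#|X| - i.+1) U c) by apply: fconnect_iter.
rewrite iter_braiding_odd // -iterD addSnnS subnK // -(orderE c).
by rewrite iter_order //; exact: diag_map_inj.
Qed.

(** If all sigma_x equal s, then U = s; and sigma is constant on the cycles of
    U, so a single cycle forces sigma_x y = sigma_y y = U y. *)
Lemma all_sigma_eq_cycleP :
  all_sigma_eq_cycle r <-> forall x y, fconnect U x y.
Proof.
split=> [[s [[c [Uc szc sE]] sigmaE]] x y|Utr].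
  have memc : c =i X.
    by apply/subset_cardP; [rewrite (card_uniqP Uc) | apply: subset_predT].
  have cU : fcycle U c.
    rewrite (eq_cycle (e' := frel (next c))) ?cycle_next // => a b.
    by rewrite /= /diag_map sigmaE sE.
  by rewrite (fconnect_cycle cU (memc x)) memc.
case: r_nbs => -[/card_gt0P[c _] _ _ _]; exists U; split.
  exists (orbit U c); split; first exact: orbit_uniq.
    by rewrite size_orbit; apply: eq_card => y; rewrite !inE Utr.
  move=> x; apply/eqP/(next_cycle (cycle_orbit diag_map_inj c)).
  by rewrite -fconnect_orbit Utr.
by move=> x y; apply: sigma_fconnect.
Qed.

(** A subset Y on which r restricts is stable under U, since U y is the first
    coordinate of r (y, y). *)
Lemma transitive_indecomposable : (forall x y, fconnect U x y) ->
  indecomposable r.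
Proof.
move=> Utr [Y [Z [/set0Pn[y Yy] /set0Pn[z Zz] _ /pred0P YZ [[rY rYE _] _]]]].
suff Yz : z \in Y by have := YZ z; rewrite !inE /= Yz Zz.
rewrite -(iter_findex (Utr y z)); elim: (findex _ _ _) => //= k Yk.
pose y' : {x | x \in Y} := exist (fun x => x \in Y) _ Yk.
have := rYE (y', y'); rewrite SD_braidingE => -[UyE _].
have -> : U (iter k U y) = \val (rY (y', y')).1 := esym UyE.
exact: valP.
Qed.

Lemma transitive_mpl1 : (forall x y, fconnect U x y) -> (1 < #|X|)%N -> mpl r 1.
Proof.
move=> Utr X_gt1; split; last first.
  by case=> // _ X1; rewrite [#|_|]X1 in X_gt1.
case: r_nbs => -[/card_gt0P[c _] _ _ _].
apply/eqP/fintype1P; exists (\pi_(retract r) c)%qT => q.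
rewrite -[q]reprK; apply/retract_piP/retract_relP; split=> z.
  exact: sigma_fconnect.
by rewrite !r_SD.
Qed.

End DiagonalMap.

(** * The bound and its equality cases *)

Theorem theorem3p3 (K : fieldType) (X : finType) (r : X * X -> X * X)
    (r_nbs : nondeg_braided_set r) (r_SD : SD r) :
  let d : rat := (dimK (homog K r 2))%:R in
  let n : rat := #|X|%:R in
  [/\ n / 2 <= d,
      ~~ odd #|X| -> (d = n / 2 <-> all_sigma_eq_cycle r),
      odd #|X| ->
        (n + 1) / 2 <= d /\ (all_sigma_eq_cycle r -> d = (n + 1) / 2)
    & forall s : X -> X,
        is_cycle_of_length s #|X| -> (forall x, sigma r x =1 s) ->
        [/\ forall a b, r (a, b) = (s b, a),
            indecomposable r
          & (1 < #|X|)%N -> mpl r 1]].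
Proof.
have r_inj : injective r by case: r_nbs => -[_ /bij_inj].
have geN := leq_double_froots r_nbs r_SD.
have cycP := all_sigma_eq_cycleP r_nbs r_SD.
rewrite dim_homog2 //; set N := #|froots r| in geN *; move=> d n.
have dE m : d = m%:R / 2 <-> N.*2 = m.
  rewrite -muln2; split=> [dE|<-].
    by apply/eqP; rewrite -(eqr_nat rat) natrM -/d dE divfK.
  by rewrite natrM mulfK.
have leE m : (m%:R / 2 <= d) = (m <= N.*2)%N.
  by rewrite ler_pdivrMr // -natrM ler_nat muln2.
split.
- by rewrite leE.
- move=> evenX; rewrite dE cycP; split=> [N2 x y|Utr].
    exact: (double_froots_transitive r_nbs r_SD).
  have := transitive_leq_froots r_nbs r_SD Utr; rewrite -/N.
  have := odd_double_half #|X|; rewrite uphalf_half (negPf evenX); lia.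
- move=> oddX; rewrite /n natr1 leE dE; have := odd_double_half #|X|.
  rewrite oddX => halfX; split; first lia.
  move=> /cycP/(transitive_leq_froots r_nbs r_SD); rewrite -/N uphalf_half oddX; lia.
- move=> s s_cyc sE; have Utr : forall x y, fconnect (diag_map r) x y.
    by apply/cycP; exists s.
  split=> [a b||X_gt1]; first by rewrite SD_braidingE // sE.
    exact: transitive_indecomposable.
  exact: transitive_mpl1.
Qed.
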